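(* Let $W$ be a Lojasiewicz-Whitney stratified space over a poset $P$, with underlying space $X\subset\mathbb R^N$. Let $p\in P$ and let $K\subset W_p$ be a compact subset. Then there exist $d,C,\alpha>0$ such that the following holds. For all $\zeta>0$ with $\frac1\zeta\in[0,d]$ there exists $\varepsilon_0>0$ such that $$d_{\mathrm{Sam}_\star}\big(T^{ex}_x(X),\mathcal M^\zeta_w(\mathbb X)\big)\le C(\zeta^{-\alpha}+\zeta\varepsilon)$$ for all $\mathbb X\subset\mathbb R^N$ with $d_{\mathrm{Hd}}(\mathbb X,X)=\varepsilon\le\varepsilon_0$, all $w\in\mathbb R^N$ and all $x\in K$ with $\|x-w\|\le\varepsilon$.
   Context: $\mathbb R^N$ carries the Euclidean norm; $B_r(x)$ is the closed ball; $A_\alpha=\{y\mid\exists x\in A:\|x-y\|\le\alpha\}$; $d_{\mathrm{Hd}}(\mathbb X,\mathbb X')=\inf\{\alpha>0\mid\mathbb X\subset\mathbb X'_\alpha,\ \mathbb X'\subset\mathbb X_\alpha\}$ for arbitrary subsets of $\mathbb R^N$ (value $\infty$ allowed). For $\mathbb B,\mathbb B'\subset\mathbb R^N$: $d_{\mathrm{Sam}_\star}(\mathbb B,\mathbb B')=d_{\mathrm{Hd}}(\mathbb B\cap B_1(0),\mathbb B'\cap B_1(0))$. Magnification: $\mathcal M^\zeta_w(\mathbb X)=\zeta(\mathbb X-w)\cap B_1(0)$. Extrinsic tangent cone of $X$ at $x\in X$: $T^{ex}_x(X)=\{v\in\mathbb R^N\mid\forall\varepsilon>0\ \exists y\in B_\varepsilon(x)\cap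 X: v\in(\mathbb R_{\ge0}(y-x))_\varepsilon\}$. A stratified space over a poset $P$ is a space $X$ with a map $s:X\to P$ continuous for the Alexandrov topology (closed sets = down-closed sets); strata $W_p=s^{-1}(p)$, $W_{\le p}=s^{-1}\{q\le p\}$. $W=(X,s)$ with $X\subset\mathbb R^N$ locally closed is Whitney stratified if: every point of $X$ has a neighborhood meeting only finitely many strata; $W_p$ is dense in $W_{\le p}$ for all $p$; each $W_p$ is a smooth submanifold of $\mathbb R^N$; and (condition (b)) for $p<q$ and sequences $x_n\in W_q$, $y_n\in W_p$ converging to the same $y\in W_p$ such that the lines $l(x_n,y_n)=\mathrm{span}(x_n-y_n)$ converge to $l$ and $T_{x_n}W_q$ converge to $\tau$, one has $l\subset\tau$. For linear subspaces, $\vec d(V,U)=\sup_{v\in V,\|v\|=1}\inf_{u\in U}\|v-u\|$. Let $\beta(x,y)=\vec d(l(x,y),T_xW_{s(x)})$ for $x\neq y$ in $X$, $\beta(x,x)=0$. A Whitney stratified $W$ is Lojasiewicz-Whitney stratified if for every compact $K$ contained in a single stratum there are $\alpha>0$, $d_0>0$ with $\beta(x,y)\le\|y-x\|^\alpha$ for all $y\in K$, $x\in X\cap B_{d_0}(y)$. *)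

(* Defs.v *)
From HB Require Import structures.
From mathcomp Require Import all_boot all_order all_algebra.
From mathcomp Require Import all_classical all_reals all_analysis.

Set Implicit Arguments.
Unset Strict Implicit.
Unset Printing Implicit Defensive.

Import Order.TTheory GRing.Theory Num.Theory.
Import numFieldNormedType.Exports.

Local Open Scope classical_set_scope.
Local Open Scope ring_scope.

Section Metric.
Context {R : realType} {N : nat}.
Implicit Types (x y : 'rV[R]_N) (A B : set 'rV[R]_N) (r : R).

(* The library norm `|x| on row vectors is the sup norm; it induces the same
   topology as the Euclidean norm, so open, closed, compact, limits and
   derivatives are the library's. *)
Definition enorm x : R := Num.sqrt (\sum_(i < N) x ord0 i ^+ 2).

Definition eball x r : set 'rV[R]_N := [set y | enorm (x - y) <= r].

Definition thickening A r : set 'rV[R]_N :=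
  [set y | exists2 x, A x & enorm (x - y) <= r].

Definition hausdorff_dist A B : \bar R :=
  ereal_inf [set r%:E | r in
    [set r | [/\ 0 < r, A `<=` thickening B r & B `<=` thickening A r]]].

Definition sam_dist A B : \bar R :=
  hausdorff_dist (A `&` eball 0 1) (B `&` eball 0 1).

Definition magnification (zeta : R) (w : 'rV[R]_N) A : set 'rV[R]_N :=
  [set zeta *: (y - w) | y in A] `&` eball 0 1.

Definition ray (v : 'rV[R]_N) : set 'rV[R]_N :=
  [set t *: v | t in [set t | 0 <= t]].

Definition extrinsic_tangent_cone A x : set 'rV[R]_N :=
  [set v | forall e : R, 0 < e ->
    exists2 y, (eball x e `&` A) y & thickening (ray (y - x)) e v].

(* Used only for linear subspaces V and U, for which all the infima and the
   supremum are over bounded sets. For V = {0} the supremum is over the empty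
   set and takes the library value 0, as it should. *)
Definition vdist (V U : set 'rV[R]_N) : R :=
  sup [set inf [set enorm (v - u) | u in U]
      | v in [set v | V v /\ enorm v = 1]].

(* The gap metric, inducing the topology of the Grassmannians; subspaces of
   distinct dimensions are at distance 1. *)
Definition gap (V U : set 'rV[R]_N) : R := Num.max (vdist V U) (vdist U V).

Definition secant_line x y : {vspace 'rV[R]_N} := <[x - y]>%VS.

Definition locally_closed A : Prop :=
  exists U F : set 'rV[R]_N, [/\ open U, closed F & A = U `&` F].

End Metric.

Section Smooth.
Context {R : realType}.

Fixpoint Ck_on {V W : normedModType R} (k : nat) (U : set V) (f : V -> W)
    : Prop :=
  if k is k'.+1 then
    (forall x, U x -> differentiable f x) /\
    (forall v : V, Ck_on k' U ('D_v f))
  else forall x, U x -> {for x, continuous f}.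

Definition smooth_on {V W : normedModType R} (U : set V) (f : V -> W) : Prop :=
  forall k, Ck_on k U f.

Context {N : nat}.

(* Embedded C^oo submanifolds, through straightening diffeomorphisms
   phi : U -> V of open sets, with inverse psi, such that
   phi (M `&` U) = V `&` (R^k x 0). As k may depend on the point, distinct
   connected components may have distinct dimensions. *)
Definition smooth_submanifold (M : set 'rV[R]_N) : Prop :=
  forall x, M x ->
    exists (k : nat) (U V : set 'rV[R]_N) (phi psi : 'rV[R]_N -> 'rV[R]_N),
      [/\ (k <= N)%N,
          [/\ open U, U x & open V],
          [/\ smooth_on U phi, smooth_on V psi,
              (forall y, U y -> V (phi y) /\ psi (phi y) = y) &
              (forall z, V z -> U (psi z) /\ phi (psi z) = z)] &
          forall y, U y ->
            (M y <-> forall i : 'I_N, (k <= i)%N -> phi y ord0 i = 0)].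

(* Velocities at x of the smooth curves in M through x. *)
Definition tangent_space (M : set 'rV[R]_N) (x : 'rV[R]_N) : set 'rV[R]_N :=
  [set v | exists (e : R) (c : R -> 'rV[R]_N),
    [/\ 0 < e, smooth_on `](- e), e[%classic c,
        (forall t : R, - e < t < e -> M (c t)), c 0 = x & derive1 c 0 = v]].

End Smooth.

Section Stratified.
Context {R : realType} {N : nat} {disp : Order.disp_t} {P : porderType disp}.
(* Only the restriction of s to X is relevant. *)
Implicit Types (X : set 'rV[R]_N) (s : 'rV[R]_N -> P).

Definition alexandrov_closed (D : set P) : Prop :=
  forall q r : P, D r -> (q <= r)%O -> D q.

Definition stratification X s : Prop :=
  forall D : set P, alexandrov_closed D ->
    exists2 F : set 'rV[R]_N, closed F & X `&` s @^-1` D = X `&` F.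

Definition stratum X s (p : P) : set 'rV[R]_N := [set x | X x /\ s x = p].

Definition stratum_le X s (p : P) : set 'rV[R]_N :=
  [set x | X x /\ (s x <= p)%O].

Definition whitney_b (Wq Wp : set 'rV[R]_N) : Prop :=
  forall (x y : nat -> 'rV[R]_N) (z : 'rV[R]_N) (l tau : {vspace 'rV[R]_N}),
    (forall n, Wq (x n)) -> (forall n, Wp (y n)) -> Wp z ->
    x @ \oo --> z -> y @ \oo --> z ->
    (fun n => gap [set` secant_line (x n) (y n)] [set` l]) @ \oo --> (0 : R) ->
    (fun n => gap (tangent_space Wq (x n)) [set` tau]) @ \oo --> (0 : R) ->
    (l <= tau)%VS.

Record whitney_stratified X s : Prop := WhitneyStratified {
  whitney_locally_closed : locally_closed X;
  whitney_stratification : stratification X s;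
  whitney_locally_finite : forall x, X x ->
    exists2 U : set 'rV[R]_N, nbhs x U &
      finite_set [set p | stratum X s p `&` U !=set0];
  whitney_dense : forall p, stratum_le X s p `<=` closure (stratum X s p);
  whitney_smooth : forall p, smooth_submanifold (stratum X s p);
  whitney_condition_b : forall p q, (p < q)%O ->
    whitney_b (stratum X s q) (stratum X s p)
}.

Definition beta X s (x y : 'rV[R]_N) : R :=
  if x == y then 0
  else vdist [set` secant_line x y] (tangent_space (stratum X s (s x)) x).

Definition lojasiewicz_whitney X s : Prop :=
  whitney_stratified X s /\
  forall (K : set 'rV[R]_N) (p : P), compact K -> K `<=` stratum X s p ->
    exists alpha d0 : R, [/\ 0 < alpha, 0 < d0 &
      forall x y, K y -> (X `&` eball y d0) x ->
        beta X s x y <= enorm (y - x) `^ alpha].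

End Stratified.

(* Main.v *)
Require Import Defs.
From HB Require Import structures.
From mathcomp Require Import all_boot all_order all_algebra.
From mathcomp Require Import all_classical all_reals all_analysis.
From mathcomp Require Import ring lra.

Import Order.TTheory GRing.Theory Num.Theory.
Import numFieldNormedType.Exports.
Local Open Scope classical_set_scope.
Local Open Scope ring_scope.

(** Fix [x] in [K]. By the Lojasiewicz condition, at a point [y] of [X] near [x]
the stratum of [y] has a tangent vector that differs from the unit vector
[direction x y] by at most a multiple of [enorm (y - x) `^ a] ([beta_tangent]).
Following such tangents one moves inside [X] towards or away from [x]. If [rho]
is the distance from [x], then the direction turns at a rate of order
[rho `^ (a - 1)] with respect to [rho]; as this is integrable at [0], the total
rotation between two radii is bounded by a multiple of the difference of their
[a]-th powers ([radial_step], [radial_flow]). No vector field is integrated: as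
[X] is locally closed, the points near [x] reached with the permitted rotation
form a compact set between two positive radii, and a point of this set closest
to the desired radius must have that radius, for otherwise one more step would
improve it.

Flowing a point of [X] at distance at most [2 / zeta] into [x] shows that its
direction is within a multiple of [zeta `^ (- a)] of a ray of the tangent cone
([direction_limit]). Flowing points very close to [x] outwards shows that every
tangent vector is, after rescaling and up to an error of the same order, realized
by a point of [X] at any prescribed small distance ([tangent_vector_approx]).
This compares the tangent cone with the magnification of [X] at [x]. Replacing
[X] by [Y] and [x] by [w] displaces points by at most a multiple of [eps], which
magnification turns into [zeta * eps] ([sam_dist_magnification_le]). *)

(** * The Euclidean norm *)

(** On row vectors, [nbhs y] unfolds to a form to which the limit lemmas no
longer apply; an abstract filter does not. *)
Lemma continuous_at_filter {U V : topologicalType} (f : U -> V) (y : U) :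
  (forall F : set_system U, Filter F -> F --> y -> f z @[z --> F] --> f y) ->
  {for y, continuous f}.
Proof. by apply; exact: cvg_id. Qed.

Section EuclideanNorm.
Context {R : realType} {N : nat}.
Implicit Types (x y : 'rV[R]_N) (a : R).

Lemma enorm_ge0 x : 0 <= enorm x.
Proof. exact: sqrtr_ge0. Qed.

Lemma sqr_enorm x : enorm x ^+ 2 = \sum_(i < N) x ord0 i ^+ 2.
Proof. by rewrite sqr_sqrtr// sumr_ge0// => i _; rewrite sqr_ge0. Qed.

Lemma enormZ a x : enorm (a *: x) = `|a| * enorm x.
Proof.
rewrite /enorm -sqrtr_sqr -sqrtrM ?sqr_ge0// mulr_sumr.
by congr Num.sqrt; apply: eq_bigr => i _; rewrite mxE exprMn.
Qed.

Lemma enorm0 : enorm (0 : 'rV[R]_N) = 0.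
Proof. by rewrite -(scale0r (0 : 'rV[R]_N)) enormZ normr0 mul0r. Qed.

Lemma enormN x : enorm (- x) = enorm x.
Proof. by rewrite -scaleN1r enormZ normrN1 mul1r. Qed.

Lemma enormB x y : enorm (x - y) = enorm (y - x).
Proof. by rewrite -enormN opprB. Qed.

Lemma le_coord_enorm x (i : 'I_N) : `|x ord0 i| <= enorm x.
Proof.
rewrite -sqrtr_sqr ler_sqrt; last by rewrite sumr_ge0// => j _; rewrite sqr_ge0.
by rewrite (bigD1 i)//= lerDl sumr_ge0// => j _; rewrite sqr_ge0.
Qed.

Lemma enorm_eq0 x : enorm x = 0 -> x = 0.
Proof.
move=> x0; apply/rowP => i; rewrite mxE; apply/eqP; rewrite -normr_eq0; apply/eqP/le_anti.
by rewrite normr_ge0 -{1}x0 le_coord_enorm.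
Qed.

Lemma enorm_gt0 x : x != 0 -> 0 < enorm x.
Proof.
by rewrite lt_neqAle enorm_ge0 andbT; apply: contra => /eqP/esym/enorm_eq0/eqP.
Qed.

Lemma le_mx_norm_enorm x : `|x| <= enorm x.
Proof.
have [x0|/mx_norm_neq0[i xi]] := eqVneq (mx_norm x) 0.
  by apply: le_trans (enorm_ge0 x); rewrite -x0; exact: lexx.
apply: le_trans (le_coord_enorm x i.2).
by move: xi; rewrite (ord1 i.1) => <-; exact: lexx.
Qed.

(** For nonzero vectors this is the nonnegativity of the sum of the squares of
[enorm y * x i - enorm x * y i], divided by [2 * (enorm x * enorm y)]. *)
Lemma cauchy_schwarz x y :
  \sum_(i < N) x ord0 i * y ord0 i <= enorm x * enorm y.
Proof.
set a := enorm x; set b := enorm y.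
have [->|xn0] := eqVneq x 0.
  rewrite big1 ?mulr_ge0 ?enorm_ge0// => i _; by rewrite mxE mul0r.
have [->|yn0] := eqVneq y 0.
  rewrite big1 ?mulr_ge0 ?enorm_ge0// => i _; by rewrite mxE mulr0.
have a0 : 0 < a by exact: enorm_gt0.
have b0 : 0 < b by exact: enorm_gt0.
have : 0 <= \sum_(i < N) (b * x ord0 i - a * y ord0 i) ^+ 2.
  by rewrite sumr_ge0// => i _; rewrite sqr_ge0.
have -> : \sum_(i < N) (b * x ord0 i - a * y ord0 i) ^+ 2 =
    b ^+ 2 * (\sum_(i < N) x ord0 i ^+ 2)
      + a ^+ 2 * (\sum_(i < N) y ord0 i ^+ 2)
      - 2 * (a * b) * \sum_(i < N) x ord0 i * y ord0 i.
  rewrite !mulr_sumr -big_split -sumrB /=.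
  by apply: eq_bigr => i _; ring.
rewrite -!sqr_enorm -/a -/b; set S := \sum_(i < N) _ * _.
have -> : b ^+ 2 * a ^+ 2 + a ^+ 2 * b ^+ 2 - 2 * (a * b) * S =
    (2 * (a * b)) * (a * b - S) by ring.
by rewrite pmulr_rge0 ?subr_ge0// !mulr_gt0.
Qed.

Lemma ler_enormD x y : enorm (x + y) <= enorm x + enorm y.
Proof.
rewrite -ler_sqr ?nnegrE ?addr_ge0 ?enorm_ge0// sqr_enorm sqrrD 2!sqr_enorm.
have -> : \sum_(i < N) (x + y) ord0 i ^+ 2 = \sum_(i < N) x ord0 i ^+ 2 +
    (\sum_(i < N) x ord0 i * y ord0 i) *+ 2 + \sum_(i < N) y ord0 i ^+ 2.
  rewrite -sumrMnl -!big_split /=; apply: eq_bigr => i _.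
  by rewrite mxE sqrrD.
by rewrite lerD2r lerD2l ler_pMn2r// cauchy_schwarz.
Qed.

Lemma ler_enorm_dist x y : `|enorm x - enorm y| <= enorm (x - y).
Proof.
rewrite ler_norml; apply/andP; split.
  have := ler_enormD (y - x) x; rewrite subrK enormB; lra.
have := ler_enormD (x - y) y; rewrite subrK; lra.
Qed.

Lemma enorm_continuous : continuous (@enorm R N).
Proof.
move=> x.
have sum_cvg : \sum_(i < N) z ord0 i ^+ 2 @[z --> x]
    --> \sum_(i < N) x ord0 i ^+ 2.
  have xF : Filter (nbhs x) by exact: nbhs_filter.
  apply: (@cvg_big _ _ _ _ _ _ _ (nbhs x)) => [|i _]; first exact: add_continuous.
  have xi := @coord_continuous R 1 N ord0 i x.
  by apply: cvgM; exact: xi.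
apply: (cvg_comp _ _ sum_cvg); exact: sqrt_continuous.
Qed.

Lemma cvg_enorm {T : Type} (F : set_system T) (f : T -> 'rV[R]_N) (l : 'rV[R]_N) :
  f z @[z --> F] --> l -> enorm (f z) @[z --> F] --> enorm l.
Proof. by move=> fl; apply: (cvg_comp _ _ fl); exact: enorm_continuous. Qed.

End EuclideanNorm.

(** * A lower bound for increments of powers *)

(** Apply [ln u <= u - 1] to [u = (1 + t)^-1], and bound [1 + t] by [2]. *)
Lemma ln1D_ge {R : realType} (t : R) : 0 <= t <= 1 -> t / 2 <= ln (1 + t).
Proof.
move=> /andP[t0 t1]; have t1gt0 : 0 < 1 + t by rewrite ltr_pwDl.
have := @le_ln1Dx R ((1 + t)^-1 - 1).
rewrite subrKC lnV ?posrE// ltrBrDr addNr invr_gt0 => /(_ t1gt0).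
rewrite lerNl => /(le_trans _); apply.
have -> : - ((1 + t)^-1 - 1) = t / (1 + t) by field; lra.
by rewrite ler_wpM2l// lef_pV2 ?posrE//; lra.
Qed.

(** A substitute for the mean value theorem with constant [a / 2] in place of
[a]: by [1 + u <= expR u], the relative increment of the power is at least
[a * ln (1 + h / m)]. *)
Lemma powR_increment_ge {R : realType} (a m h : R) : 0 < a -> 0 < m ->
  0 <= h <= m -> a * m `^ a * (h / (2 * m)) <= (m + h) `^ a - m `^ a.
Proof.
move=> a0 m0 /andP[h0 hm].
have hm1 : 0 <= h / m <= 1 by rewrite divr_ge0 ?(ltW m0)//= ler_pdivrMr ?mul1r.
have -> : m + h = m * (1 + h / m) by field; lra.
have mh0 : 0 < 1 + h / m by rewrite ltr_pwDl//; case/andP: hm1.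
rewrite powRM ?(ltW m0) ?(ltW mh0)//.
have : 1 + a * (h / m / 2) <= (1 + h / m) `^ a.
  rewrite -[leRHS](@lnK R) ?posrE ?powR_gt0// ln_powR.
  apply: le_trans (expR_ge1Dx _).
  by rewrite lerD2l ler_wpM2l ?(ltW a0)// ln1D_ge.
have ma : 0 < m `^ a by exact: powR_gt0.
move=> /(ler_wpM2l (ltW ma)); rewrite mulrDr mulr1 => H.
have -> : a * m `^ a * (h / (2 * m)) = m `^ a * (a * (h / m / 2)) by field; lra.
lra.
Qed.

Lemma ler_powR_base {R : realType} (a m n : R) : 0 <= a -> 0 < m -> m <= n ->
  m `^ a <= n `^ a.
Proof.
move=> a0 m0 mn; apply: ge0_ler_powR => //; rewrite nnegrE; first exact: ltW.
exact: le_trans (ltW m0) mn.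
Qed.

Lemma le_dist_between {R : realType} (s t r : R) :
  s <= t <= r \/ r <= t <= s -> `|r - t| + `|t - s| <= `|r - s|.
Proof.
case=> /andP[h1 h2]; have h3 := le_trans h1 h2.
  by rewrite !ger0_norm ?subr_ge0// addrA subrK.
by rewrite !ler0_norm ?subr_le0// -opprD addrA subrK.
Qed.

(** * Moving along the strata towards or away from a point *)

(** The constant of [rotation_rate_le]: how much the direction from a fixed point
may turn per unit of change of the [a]-th power of the distance to that point. *)
Definition rotation_rate {R : realType} (a : R) : R := 24 * 2 `^ a / a.

Section RadialMotion.
Context {R : realType} {N : nat}.
Implicit Types (x y u e : 'rV[R]_N) (A : set 'rV[R]_N) (a r C D : R).

(** The unit vector pointing from [x] to [y]; it is [0] for [y = x]. *)
Definition direction x y : 'rV[R]_N := (enorm (y - x))^-1 *: (y - x).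

Lemma enorm_direction x y : 0 < enorm (y - x) -> enorm (direction x y) = 1.
Proof.
move=> yx; rewrite enormZ ger0_norm ?invr_ge0 ?(ltW yx)// mulVf//.
by rewrite gt_eqF.
Qed.

Lemma scale_direction x y : enorm (y - x) *: direction x y = y - x.
Proof.
have [/eqP/enorm_eq0 ->|yx] := boolP (enorm (y - x) == 0).
  by rewrite enorm0 scale0r.
by rewrite scalerA divff// scale1r.
Qed.

(** What the radial motion needs to know about velocities of curves in the strata.
As [t] takes both signs, [A] can be followed in the directions [u] and [- u], that
is, both away from a point and towards it. *)
Definition first_order_tangent A y u : Prop :=
  forall eta : R, 0 < eta -> exists2 delta : R, 0 < delta &
    forall t : R, `|t| <= delta ->
      exists2 y', A y' & enorm (y' - (y + t *: u)) <= eta * `|t|.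

(** Moving [w] first to the point [l *: e] of the ray of [e], and then along this
ray to the point of the same length as [w], costs the same amount twice. *)
Lemma enorm_ray_perturbation e (w : 'rV[R]_N) (l : R) : enorm e = 1 -> 0 <= l ->
  `|enorm w - l| <= enorm (w - l *: e) /\
  enorm (w - enorm w *: e) <= 2 * enorm (w - l *: e).
Proof.
move=> e1 l0.
have le : enorm (l *: e) = l by rewrite enormZ e1 mulr1 ger0_norm.
have wl : `|enorm w - l| <= enorm (w - l *: e) by rewrite -{1}le ler_enorm_dist.
split=> //; have -> : w - enorm w *: e = (w - l *: e) + (l - enorm w) *: e.
  by rewrite scalerBl addrA subrK.
apply: (le_trans (ler_enormD _ _)).
by rewrite enormZ e1 mulr1 distrC; lra.
Qed.

Lemma rotation_rate_ge0 a : 0 < a -> 0 <= rotation_rate a.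
Proof. by move=> a0; rewrite divr_ge0 ?(ltW a0)// mulr_ge0// powR_ge0. Qed.

(** The left-hand side is the rotation produced by a tangent that deviates from
the radial direction by at most a multiple of [r `^ a]. Since [12 * r `^ (a - 1)]
is [12 / a] times the derivative of the [a]-th power, the rotation is bounded by
the change of that power, with a loss of [2] from [powR_increment_ge] and of
[2 `^ a] when the radius decreases. *)
Lemma rotation_rate_le a r r' : 0 < a -> 0 < r -> r / 2 <= r' <= 2 * r ->
  12 * r `^ a * `|r' - r| / r' <= rotation_rate a * `|r' `^ a - r `^ a|.
Proof.
move=> a0 r0 /andP[r'r r'2r].
have r'0 : 0 < r' by lra.
have ra0 : 0 < r `^ a by exact: powR_gt0.
have r'a0 : 0 < r' `^ a by exact: powR_gt0.
have two_a : 1 <= 2 `^ a.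
  have := @ge0_ler_powR R a (ltW a0) 1 2; rewrite powR1; apply; rewrite ?nnegrE; lra.
rewrite /rotation_rate; set c := 2 `^ a in two_a *.
have [rr'|r'r1] := leP r r'.
  have rr'a : r `^ a <= r' `^ a by apply: ge0_ler_powR; rewrite ?nnegrE; lra.
  rewrite !ger0_norm ?subr_ge0//.
  have := @powR_increment_ge R a r (r' - r) a0 r0.
  rewrite subrKC => /(_ _)/wrap[]; first lra.
  set Q := r' `^ a - r `^ a; set B := r `^ a => H.
  have H1 : 12 * B * (r' - r) / r' <= 24 / a * (a * B * ((r' - r) / (2 * r))).
    have -> : 24 / a * (a * B * ((r' - r) / (2 * r))) = 12 * B * (r' - r) / r.
      by field; lra.
    by rewrite ler_wpM2l// ?lef_pV2 ?posrE// !mulr_ge0// ?subr_ge0// ltW.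
  apply: (le_trans H1).
  apply: (@le_trans _ _ (24 / a * Q)); first by rewrite ler_wpM2l// divr_ge0// ltW.
  have -> : 24 * c / a * Q = c * (24 / a * Q) by ring.
  rewrite ler_peMl// mulr_ge0// ?subr_ge0// divr_ge0// ltW//.
have rr'a : r' `^ a <= r `^ a by apply: ge0_ler_powR; rewrite ?nnegrE; lra.
rewrite !ler0_norm ?subr_le0// ?(ltW r'r1)// !opprB.
have := @powR_increment_ge R a r' (r - r') a0 r'0.
rewrite subrKC => /(_ _)/wrap[]; first lra.
have : r `^ a <= c * r' `^ a.
  by rewrite -powRM ?(ltW r'0)//; apply: ge0_ler_powR; rewrite ?nnegrE; lra.
set Q := r `^ a - r' `^ a; set B := r `^ a; set B' := r' `^ a => HB H.
apply: (@le_trans _ _ (24 * c / a * (a * B' * ((r - r') / (2 * r'))))); last first.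
  by rewrite ler_wpM2l// divr_ge0 ?(ltW a0)// mulr_ge0//; lra.
have -> : 24 * c / a * (a * B' * ((r - r') / (2 * r'))) =
   12 * (c * B') * ((r - r') / r') by field; lra.
rewrite -mulrA ler_wpM2r//; first by rewrite divr_ge0 ?subr_ge0 ?ltW.
by rewrite ler_wpM2l.
Qed.

(** A flow stripped of its trajectories: only the end points of the motion are
recorded. As [r'] tends to [0] the permitted rotation stays bounded by
[C * enorm (y0 - x) `^ a], which is what makes directions converge at [x]. *)
Definition has_radial_flow A x D C a : Prop := forall (y0 : 'rV[R]_N) r',
  A y0 -> 0 < enorm (y0 - x) <= D -> 0 < r' <= D ->
  exists y, [/\ A y, enorm (y - x) = r' &
    enorm (direction x y - direction x y0) <=
      C * `|r' `^ a - enorm (y0 - x) `^ a| ].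

(** Following a nearly radial tangent for a short time [t] changes the distance
from [x] by about [t], whereas only the deviation of [u] from the radial
direction, of order [enorm (y - x) `^ a], turns the direction. *)
Lemma radial_step A x y u a : 0 < a -> 0 < enorm (y - x) ->
  enorm (y - x) `^ a <= 1 / 6 -> first_order_tangent A y u ->
  enorm (u - direction x y) <= 2 * enorm (y - x) `^ a ->
  exists2 delta : R, 0 < delta & forall t, `|t| <= delta ->
    exists2 y', A y' &
      `|enorm (y' - x) - (enorm (y - x) + t)| <= `|t| / 2 /\
      enorm (direction x y' - direction x y) <=
        rotation_rate a * `|enorm (y' - x) `^ a - enorm (y - x) `^ a|.
Proof.
set rho := enorm (y - x); set e := direction x y => a0 rho0 rhoa tanu ue.
have b0 : 0 < rho `^ a by exact: powR_gt0.
have [delta0 delta00 move_u] := tanu _ b0.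
exists (Num.min delta0 (rho / 4)); first by rewrite lt_min delta00 divr_gt0.
move=> t; rewrite le_min => /andP[/move_u[y' Ay' y't] trho].
exists y' => //.
have e1 : enorm e = 1 by exact: enorm_direction.
have rhot : 0 <= rho + t by move: trho; rewrite ler_norml; lra.
have [ray1 ray2] := enorm_ray_perturbation _ (y' - x) _ e1 rhot.
set r' := enorm (y' - x) in ray1 ray2 *.
have dev : enorm (y' - x - (rho + t) *: e) <= 3 * rho `^ a * `|t|.
  (* The first-order error contributes one part in three, u - e the other two. *)
  have -> : y' - x - (rho + t) *: e = (y' - (y + t *: u)) + t *: (u - e).
    rewrite scalerDl scale_direction scalerBr.
    by apply/rowP => i; rewrite !mxE; ring.
  apply: (le_trans (ler_enormD _ _)); rewrite enormZ.
  have := ler_wpM2l (normr_ge0 t) ue; lra.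
have dev2 : 3 * rho `^ a * `|t| <= `|t| / 2.
  by rewrite [leRHS]mulrC ler_wpM2r//; lra.
have r'rho : `|r' - (rho + t)| <= `|t| / 2 by lra.
split=> //.
have bounds : rho / 2 <= r' <= 2 * rho.
  have t4 : - (rho / 4) <= t <= rho / 4 by rewrite -ler_norml.
  move: r'rho; rewrite ler_norml; lra.
apply: le_trans (rotation_rate_le _ _ _ a0 rho0 bounds).
have r'0 : 0 < r' by lra.
have t2 : `|t| <= 2 * `|r' - rho|.
  have := ler_normB (r' - rho) (r' - (rho + t)).
  have -> : r' - rho - (r' - (rho + t)) = t by ring.
  lra.
have -> : direction x y' - e = r'^-1 *: (y' - x - r' *: e).
  by rewrite scalerBr scalerA mulVf ?scale1r// gt_eqF.
rewrite enormZ ger0_norm ?invr_ge0 ?(ltW r'0)// mulrC ler_wpM2r ?invr_ge0 ?(ltW r'0)//.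
apply: (le_trans ray2); have := ler_wpM2l (ltW b0) t2; lra.
Qed.

(** Minimization replaces the integration of a vector field: on the compact set of
points reached with at most the permitted rotation, the distance to the radius
[r'] attains its minimum, and a nonzero minimum could be lowered by
[radial_step]. *)
Lemma radial_flow A x D a : 0 < a -> D `^ a <= 1 / 6 ->
  compact (A `&` eball x D) ->
  (forall y, A y -> 0 < enorm (y - x) <= D -> exists2 u,
    first_order_tangent A y u &
    enorm (u - direction x y) <= 2 * enorm (y - x) `^ a) ->
  has_radial_flow A x D (rotation_rate a) a.
Proof.
move=> a0 Da cA tanA y0 r' Ay0 /andP[r00 r0D] /andP[r'0 r'D].
set r0 := enorm (y0 - x) in r00 r0D *.
pose m := Num.min r0 r'; pose M := Num.max r0 r'.
have m0 : 0 < m by rewrite lt_min r00.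
have MD : M <= D by rewrite ge_max r0D.
pose rho (y : 'rV[R]_N) := enorm (y - x).
have rho_cont : continuous rho.
  move=> y; apply: continuous_at_filter => F FF Fy; apply: cvg_enorm.
  by apply: cvgB => //; exact: cvg_cst.
(* The radius is truncated from below so that the rotation is continuous
   everywhere; all radii considered are at least m. *)
pose trunc (y : 'rV[R]_N) := Num.max m (rho y).
have trunc_gt0 y : 0 < trunc y by rewrite lt_max m0.
have trunc_cont : continuous trunc.
  move=> y; apply: continuous_at_filter => F FF Fy.
  apply: (cvg_comp _ _ (cvg_comp _ _ Fy (rho_cont y))).
  by apply: (@continuous_max R R (cst m) id); [exact: cvg_cst|exact: cvg_id].
pose excess (y : 'rV[R]_N) :=
  enorm ((trunc y)^-1 *: (y - x) - direction x y0) -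
    rotation_rate a * `|trunc y `^ a - r0 `^ a|.
have excess_cont : continuous excess.
  move=> y; apply: continuous_at_filter => F FF Fy.
  have trF := cvg_comp _ _ Fy (trunc_cont y).
  apply: cvgB.
    apply: cvg_enorm; apply: cvgB; last exact: cvg_cst.
    apply: cvgZ; first by apply: cvgV; rewrite ?gt_eqF//; exact: trF.
    by apply: cvgB => //; exact: cvg_cst.
  apply: cvgM; first exact: cvg_cst.
  apply: cvg_norm; apply: cvgB; last exact: cvg_cst.
  have powc : {for trunc y, continuous (fun r : R => r `^ a)}.
    apply: differentiable_continuous; apply/derivable1_diffP.
    by apply: derivable_powR; rewrite in_itv/= trunc_gt0.
  exact: (cvg_comp _ _ trF powc).
have excessE y : m <= rho y -> excess y =
    enorm (direction x y - direction x y0) -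
    rotation_rate a * `|rho y `^ a - r0 `^ a|.
  by move=> my; rewrite /excess /trunc max_r.
clearbody excess.
pose S := (A `&` eball x D) `&`
  (rho @^-1` [set r | m <= r] `&` rho @^-1` [set r | r <= M] `&`
   excess @^-1` [set r | r <= 0]).
have cS : compact S.
  apply: compact_closedI => //; apply: closedI; first apply: closedI.
  - by apply: preimage_closed; [move=> ? _; exact: rho_cont|exact: closed_ge].
  - by apply: preimage_closed; [move=> ? _; exact: rho_cont|exact: closed_le].
  - by apply: preimage_closed; [move=> ? _; exact: excess_cont|exact: closed_le].
have eballE (y : 'rV[R]_N) : rho y <= D -> eball x D y.
  by rewrite /eball /= enormB.
have Sy0 : S y0.
  split; first by split=> //; exact: eballE.
  split; first by split; rewrite /= ?ge_min ?le_max lexx.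
  rewrite /= excessE; last by rewrite ge_min lexx.
  by rewrite subrr enorm0 subrr normr0 mulr0 subr0.
have [||y yS ymin] := @EVT_min_rV R N (fun y => `|rho y - r'|) S _ cS.
- by exists y0.
- apply: continuous_subspaceT => y.
  apply: continuous_at_filter => F FF Fy.
  apply: cvg_norm; apply: cvgB; last exact: cvg_cst.
  exact: (cvg_comp _ _ Fy (rho_cont y)).
move: yS; rewrite inE => -[[Ay _] [[/= my yM] /=]]; rewrite excessE// => excy.
have [yr'|yr'] := eqVneq (rho y) r'.
  exists y; split=> //; move: excy; rewrite /excess yr'; lra.
have rhoy0 : 0 < rho y by exact: lt_le_trans my.
have rhoyD : rho y <= D by exact: le_trans yM MD.
have [u tanu udir] := tanA y Ay (introT andP (conj rhoy0 rhoyD)).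
have rhoa : rho y `^ a <= 1 / 6.
  by apply: le_trans Da; apply: ler_powR_base => //; exact: ltW.
have [delta delta0 step] := radial_step _ _ _ _ _ a0 rhoy0 rhoa tanu udir.
exfalso.
have C0 := rotation_rate_ge0 a a0; set C := rotation_rate a in C0 excy excessE step.
(* A point closer to the radius r', turned by at most the permitted amount on
   the way from y, contradicts minimality: between r0 and r' the permitted
   amounts add up. *)
have closer (y1 : 'rV[R]_N) : A y1 -> `|rho y1 - r'| < `|rho y - r'| ->
    m <= rho y1 <= M ->
    enorm (direction x y1 - direction x y) <= C * `|rho y1 `^ a - rho y `^ a| ->
    `|rho y1 `^ a - rho y `^ a| + `|rho y `^ a - r0 `^ a| <=
      `|rho y1 `^ a - r0 `^ a| -> False.
  move=> Ay1 y1r' /andP[my1 y1M] diry1 between.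
  suff Sy1 : S y1 by have := ymin y1; rewrite inE leNgt y1r' => /(_ Sy1).
  split; first by split=> //; apply: eballE; rewrite (le_trans y1M).
  split; first by split.
  change (excess y1 <= 0); rewrite (excessE _ my1) subr_le0.
  apply: le_trans (ler_wpM2l C0 between); rewrite mulrDr.
  have -> : direction x y1 - direction x y0 =
    (direction x y1 - direction x y) + (direction x y - direction x y0).
    by rewrite addrA subrK.
  by apply: (le_trans (ler_enormD _ _)); apply: lerD; [exact: diry1|rewrite -subr_le0; exact: excy].
(* A step of at most half the remaining distance does not overshoot. *)
pose tau := Num.min delta (`|rho y - r'| / 2).
have tau0 : 0 < tau by rewrite lt_min delta0 divr_gt0// normr_gt0 subr_eq0.
have taudelta : tau <= delta by rewrite ge_min lexx.
have taur' : tau <= `|rho y - r'| / 2 by rewrite ge_min lexx orbT.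
have [r0r'|r'r0] := leP r0 r'.
  have mE : m = r0 by rewrite /m min_l.
  have ME : M = r' by rewrite /M max_r.
  have [|y1 Ay1 [y1rho y1dir]] := step tau; first by rewrite gtr0_norm.
  have {}y1rho : rho y + tau / 2 <= rho y1 <= rho y + 3 / 2 * tau.
    move: y1rho; rewrite (gtr0_norm tau0) -/(rho y) -/(rho y1) ler_norml.
    by clear; lra.
  have rr : rho y < r' by rewrite lt_neqAle yr' -ME.
  have absE : `|rho y - r'| = r' - rho y by rewrite ltr0_norm ?subr_lt0// opprB.
  rewrite absE in taur'.
  have y1y : rho y <= rho y1 by move: y1rho tau0; clear; lra.
  have y1r' : rho y1 <= r' by move: y1rho taur' rr; clear; lra.
  have p1 := ler_powR_base _ _ _ (ltW a0) rhoy0 y1y.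
  have p2 : r0 `^ a <= rho y `^ a.
    by apply: ler_powR_base; [exact: ltW|exact: r00|rewrite -mE].
  apply: (closer y1) => //.
  - rewrite absE ler0_norm ?subr_le0//; move: y1rho tau0; clear; lra.
  - by rewrite ME y1r' (le_trans my).
  - by apply: le_dist_between; left; apply/andP; split; [exact: p2|exact: p1].
have mE : m = r' by rewrite /m min_r// ltW.
have ME : M = r0 by rewrite /M max_l// ltW.
have [|y1 Ay1 [y1rho y1dir]] := step (- tau); first by rewrite normrN gtr0_norm.
have {}y1rho : rho y - 3 / 2 * tau <= rho y1 <= rho y - tau / 2.
  move: y1rho; rewrite normrN (gtr0_norm tau0) -/(rho y) -/(rho y1) ler_norml.
  by clear; lra.
have rr : r' < rho y by rewrite lt_neqAle eq_sym yr' -mE.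
have absE : `|rho y - r'| = rho y - r' by rewrite gtr0_norm ?subr_gt0.
rewrite absE in taur'.
have y1y : rho y1 <= rho y by move: y1rho tau0; clear; lra.
have y1r' : r' <= rho y1 by move: y1rho taur' rr; clear; lra.
have p1 := ler_powR_base _ _ _ (ltW a0) (lt_le_trans r'0 y1r') y1y.
have p2 : rho y `^ a <= r0 `^ a.
  by apply: ler_powR_base; [exact: ltW|exact: rhoy0|rewrite -ME].
apply: (closer y1) => //.
- rewrite absE ger0_norm ?subr_ge0//; move: y1rho tau0; clear; lra.
- by rewrite mE y1r' (le_trans y1y).
- by apply: le_dist_between; right; apply/andP; split; [exact: p1|exact: p2].
Qed.

End RadialMotion.

(** * Tangent spaces, secants and compactness *)

Section Strata.
Context {R : realType} {N : nat}.
Implicit Types (x y u v : 'rV[R]_N) (A M X K : set 'rV[R]_N).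

Lemma tangent_space_first_order M A y u : M `<=` A ->
  tangent_space M y u -> first_order_tangent A y u.
Proof.
move=> MA [e [c [e0 smooth_c cM c0 cu]]] eta eta0.
have /derivable1_diffP dc : differentiable c 0.
  by have [+ _] := smooth_c 1%N; apply; rewrite /= in_itv/= oppr_lt0 e0.
have quot : h^-1 *: (c (h + 0) - c 0) @[h --> 0^'] --> u.
  rewrite -cu /derive1; move: dc; rewrite /derivable.
  by under eq_fun do rewrite /= [_ *: 1]mulr1.
have err : enorm (h^-1 *: (c (h + 0) - c 0) - u) @[h --> 0^'] --> enorm (u - u).
  by apply: cvg_enorm; apply: cvgB => //; exact: cvg_cst.
rewrite subrr enorm0 in err.
have /= /nbhs_ballP[d /= d0 dP] : \forall h \near 0^',
    enorm (h^-1 *: (c (h + 0) - c 0) - u) < eta.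
  exact: (cvgr_lt _ err).
exists (Num.min (d / 2) (e / 2)); first by rewrite lt_min !divr_gt0.
move=> t; rewrite le_min => /andP[td te].
exists (c t); first by apply/MA/cM; rewrite -ltr_norml; lra.
have [->|t0] := eqVneq t 0.
  by rewrite c0 scale0r addr0 subrr enorm0 normr0 mulr0.
have := dP t; rewrite /ball /= sub0r normrN => /(_ _ t0)/wrap[]; first lra.
rewrite addr0 c0 => /ltW.
have -> : c t - (y + t *: u) = t *: (t^-1 *: (c t - y) - u).
  by rewrite scalerBr scalerA divff// scale1r opprD addrA.
by rewrite enormZ mulrC => h; rewrite ler_wpM2r.
Qed.

Lemma tangent_space0 M y : M y -> tangent_space M y 0.
Proof.
move=> My; exists 1, (cst y); split=> //.
- move=> k; elim: k y {My} => [|k IH] y /=.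
    by move=> ? _; exact: cst_continuous.
  split=> [? _|v]; first exact: differentiable_cst.
  have -> : 'D_v (cst y) = cst (0 : 'rV[R]_N).
    by apply/funext => z; rewrite derive_cst.
  exact: IH.
- by rewrite derive1_cst.
Qed.

(** All the infima in [vdist V U] are at most [1] because [U] contains [0], so the
supremum is a genuine one. *)
Lemma vdist_lt (V U : set 'rV[R]_N) v (e : R) : U 0 -> V v -> enorm v = 1 ->
  vdist V U < e -> exists2 u, U u & enorm (v - u) < e.
Proof.
move=> U0 Vv v1 VUe.
have inf_has w : has_inf [set enorm (w - u) | u in U].
  split; first by exists (enorm (w - 0)), 0.
  by exists 0 => _ [u _ <-]; exact: enorm_ge0.
have infv : inf [set enorm (v - u) | u in U] <= vdist V U.
  apply: ub_le_sup; last by exists v.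
  exists 1 => _ [w [_ w1] <-].
  apply: (@le_trans _ _ (enorm (w - 0))); last by rewrite subr0 w1.
  by apply: ge_inf; [exact: (inf_has w).2|exists 0].
have gap0 : 0 < e - inf [set enorm (v - u) | u in U].
  by rewrite subr_gt0; exact: le_lt_trans VUe.
have [_ [u Uu <-]] := inf_adherent gap0 (inf_has v).
by rewrite subrKC => vu; exists u.
Qed.

(** The direction from [x] to [y] spans the secant, so a bound on [beta] provides
a tangent of the stratum of [y] that is almost radial with respect to [x]. *)
Lemma beta_tangent {disp : Order.disp_t} {P : porderType disp} X
    (s : 'rV[R]_N -> P) x y (b : R) : X y -> 0 < enorm (y - x) ->
  beta X s y x < b ->
  exists2 u, first_order_tangent X y u & enorm (u - direction x y) <= b.
Proof.
move=> Xy yx; rewrite /beta; case: eqP => [yxE|_ betab].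
  by move: yx; rewrite yxE subrr enorm0 ltxx.
have [||u Tu ub] := @vdist_lt _ _ (direction x y) _ _ _ (enorm_direction _ _ yx) betab.
- exact: tangent_space0.
- by rewrite /= rpredZ// memv_line.
exists u; last by rewrite enormB ltW.
by apply: tangent_space_first_order Tu => z [].
Qed.

Lemma closed_eball x (r : R) : closed (eball x r).
Proof.
have -> : eball x r = (fun y => enorm (x - y)) @^-1` [set t | t <= r] by [].
apply: preimage_closed; last exact: closed_le.
move=> y _; apply: continuous_at_filter => F FF Fy; apply: cvg_enorm.
by apply: cvgB => //; exact: cvg_cst.
Qed.

Lemma bounded_eball x (r : R) : bounded_set (eball x r).
Proof.
exists (`|x| + r); split; first exact: num_real.
move=> M rM y xy; apply: le_trans (ltW rM).
have -> : y = x - (x - y) by rewrite opprB addrCA subrr addr0.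
apply: (le_trans (ler_normB _ _)); rewrite lerD2l.
exact: le_trans (le_mx_norm_enorm _) xy.
Qed.

(** [K] stays at a positive distance from the complement of the open set [U] in
[X = U `&` F]; within this distance [X] coincides with the closed set [F]. *)
Lemma locally_closed_uniform X K : locally_closed X -> compact K -> K `<=` X ->
  exists2 D0 : R, 0 < D0 &
    forall x (D : R), K x -> D <= D0 -> compact (X `&` eball x D).
Proof.
move=> [U [F [oU cF ->]]] cK KUF.
have /compact_near_coveringP nK := cK.
have : \forall r \near (0 : R)^'+, K `<=` (fun x => eball x r `<=` U).
  apply: nK => x Kx.
  have /nbhs_ballP[d /= d0 dU] : nbhs x U.
    by apply: open_nbhs_nbhs; split=> //; case: (KUF _ Kx).
  exists (ball x (d / 2), [set r | r < d / 2]); first split => /=.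
  - by apply: nbhsx_ballx; rewrite divr_gt0.
  - by apply: nbhs_right_lt; rewrite divr_gt0.
  move=> [z r] /= [xz rd] y zy; apply: dU.
  apply: (@ball_split _ _ z) => //.
  rewrite -ball_normE /=.
  apply: le_lt_trans rd; exact: le_trans (le_mx_norm_enorm _) zy.
move=> near0.
have [D0 [D00 D0P]] : exists D0 : R,
    0 < D0 /\ forall x, K x -> eball x D0 `<=` U.
  near (0 : R)^'+ => D0; exists D0; split; first by [].
  exact: (near near0 D0).
exists D0 => // x D Kx DD0.
have -> : U `&` F `&` eball x D = F `&` eball x D.
  apply/seteqP; split=> y [].
    by move=> [_ ? ?].
  move=> Fy xy; split=> //; split=> //; apply: (D0P x) => //.
  exact: le_trans DD0.
apply: bounded_closed_compact; last by apply: closedI => //; exact: closed_eball.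
have [M [Mr Mb]] := bounded_eball x D.
by exists M; split=> // r Mr' y [_ xy]; exact: (Mb r).
Unshelve. all: by end_near. Qed.

End Strata.

(** * Tangent cones and magnifications *)

Section Cones.
Context {R : realType} {N : nat}.
Implicit Types (x y v w : 'rV[R]_N) (X Y : set 'rV[R]_N) (a C D r l zeta delta : R).

Lemma dist_powR_le a r r' : 0 <= a -> 0 < r -> r <= r' ->
  `|r `^ a - r' `^ a| <= r' `^ a.
Proof.
move=> a0 r0 rr'; have := ler_powR_base _ _ _ a0 r0 rr'.
by move=> h; rewrite ler0_norm ?subr_le0// opprB gerBl powR_ge0.
Qed.

(** Flow [y] towards [x]: the directions of the points reached lie in the compact
unit ball, and a cluster point of them spans a ray of the tangent cone. *)
Lemma direction_limit X x D C a y : 0 < a -> 0 <= C ->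
  has_radial_flow X x D C a -> X y -> 0 < enorm (y - x) <= D ->
  exists theta, [/\ enorm theta = 1,
    enorm (theta - direction x y) <= C * enorm (y - x) `^ a &
    forall l, 0 <= l -> extrinsic_tangent_cone X x (l *: theta)].
Proof.
move=> a0 C0 flow Xy /andP[rho0 rhoD]; set rho := enorm (y - x) in rho0 rhoD *.
have rn0 n : 0 < rho / n.+1%:R by rewrite divr_gt0.
have rn_rho n : rho / n.+1%:R <= rho by rewrite ler_pdivrMr// ler_peMr ?ler1n// ltW.
have /choice[z zP] n : exists y', [/\ X y', enorm (y' - x) = rho / n.+1%:R &
    enorm (direction x y' - direction x y) <= C * rho `^ a].
  have [||y' [Xy' y'r y'y]] := flow y (rho / n.+1%:R) Xy.
  - by rewrite rho0.
  - by rewrite rn0 (le_trans (rn_rho n)).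
  exists y'; split=> //; apply: (le_trans y'y); rewrite ler_wpM2l//.
  by apply: dist_powR_le => //; exact: ltW.
pose th n := direction x (z n).
have th1 n : enorm (th n) = 1 by apply: enorm_direction; have [_ -> _] := zP n.
have cball : compact (eball (0 : 'rV[R]_N) 1).
  by apply: bounded_closed_compact; [exact: bounded_eball|exact: closed_eball].
have [|theta [_ cl]] := cball (th @ \oo) _.
  by exists 0%N => // n _; rewrite /= /eball/= sub0r enormN th1.
have close e n : 0 < e -> exists2 m, (n <= m)%N & enorm (th m - theta) <= e.
  move=> e0.
  have [||_ [[m /= nm <-] tm]] := cl [set th m | m in [set m | (n <= m)%N]]
      [set v | enorm (v - theta) < e].
  - by exists n => // m /= nm; exists m.
  - have cont : enorm (v - theta) @[v --> theta] --> enorm (theta - theta).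
      apply: (@continuous_at_filter _ _ (fun v => enorm (v - theta))) => F FF Fy.
      by apply: cvg_enorm; apply: cvgB => //; exact: cvg_cst.
    rewrite subrr enorm0 in cont.
    exact: (cvgr_lt _ cont).
  by exists m => //; exact: ltW.
exists theta; split.
- apply/eqP; rewrite -subr_eq0 -normr_eq0; apply/eqP/le_anti; rewrite normr_ge0 andbT.
  apply/ler_addgt0Pr => e e0; rewrite add0r.
  have [m _ tm] := close e 0%N e0.
  by apply: le_trans tm; rewrite -(th1 m) distrC ler_enorm_dist.
- apply/ler_addgt0Pr => e e0.
  have [m _ tm] := close e 0%N e0.
  have [_ _ ty] := zP m.
  have -> : theta - direction x y = (th m - direction x y) + (theta - th m).
    by rewrite [RHS]addrC addrA subrK.
  by apply: (le_trans (ler_enormD _ _)); apply: lerD; rewrite // enormB.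
- move=> l l0 e e0.
  (* A strictly positive denominator also when l is 0. *)
  have l1 : 0 < l + 1 by lra.
  have [n nP] : exists n, rho / n.+1%:R <= e.
    exists (Num.truncn (rho / e)); rewrite ler_pdivrMr// mulrC -ler_pdivrMr//.
    by apply/ltW/truncnS_gt.
  have [m nm tm] := close (e / (l + 1)) n (divr_gt0 e0 l1).
  have [Xz zr _] := zP m.
  exists (z m).
    split=> //; rewrite /eball /= enormB zr; apply: le_trans nP.
    by rewrite ler_wpM2l ?(ltW rho0)// lef_pV2 ?posrE// ler_nat.
  exists (l *: th m); last first.
    rewrite -scalerBr enormZ ger0_norm//.
    apply: (le_trans (ler_wpM2l l0 tm)).
    by rewrite mulrCA ler_piMr ?(ltW e0)// ler_pdivrMr// mul1r lerDl.
  exists (l * (enorm (z m - x))^-1); last by rewrite -scalerA.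
  by rewrite /= mulr_ge0// invr_ge0 enorm_ge0.
Qed.

(** A tangent vector is approximately a multiple of [q - x] for points [q] of [X]
arbitrarily close to [x]; flow such a [q] away from [x] to the distance [r]. *)
Lemma tangent_vector_approx X x D C a v r (e : R) : 0 < a -> 0 <= C ->
  has_radial_flow X x D C a -> extrinsic_tangent_cone X x v -> v != 0 ->
  0 < r <= D -> 0 < e ->
  exists y, [/\ X y, enorm (y - x) = r &
    enorm (enorm v *: direction x y - v) <= enorm v * (C * r `^ a) + e].
Proof.
move=> a0 C0 flow Tv v0 /andP[r0 rD] e0.
have l0 : 0 < enorm v by exact: enorm_gt0.
pose e' := Num.min (e / 2) (Num.min (enorm v / 2) r).
have e'0 : 0 < e' by rewrite !lt_min !divr_gt0.
have e'e : e' <= e / 2 by rewrite ge_min lexx.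
have e'v : e' <= enorm v / 2 by rewrite !ge_min lexx orbT.
have e'r : e' <= r by rewrite !ge_min lexx !orbT.
have [q [xq Xq] [_ [t /= t0 <-] tq]] := Tv _ e'0.
rewrite /eball /= enormB in xq.
have q0 : 0 < enorm (q - x).
  rewrite lt_neqAle enorm_ge0 andbT eq_sym; apply/eqP => /enorm_eq0 qx.
  by move: tq; rewrite qx scaler0 sub0r enormN leNgt; apply/negP; rewrite negbK; lra.
have qr : enorm (q - x) <= r by exact: le_trans e'r.
have [||y [Xy yr yq]] := flow q r Xq.
- by rewrite q0 (le_trans qr).
- by rewrite r0.
exists y; split=> //.
have [_ ray] := @enorm_ray_perturbation _ _ (direction x q) v (t * enorm (q - x))
  (enorm_direction _ _ q0) (mulr_ge0 t0 (enorm_ge0 _)).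
rewrite -scalerA scale_direction (enormB v (t *: _)) in ray.
have -> : enorm v *: direction x y - v =
    enorm v *: (direction x y - direction x q) - (v - enorm v *: direction x q).
  by rewrite scalerBr opprB addrA subrK.
apply: (le_trans (ler_enormD _ _)); rewrite enormN enormZ (ger0_norm (enorm_ge0 _)).
apply: lerD; last by lra.
rewrite ler_wpM2l ?(ltW l0)//; apply: (le_trans yq); rewrite ler_wpM2l// distrC.
by apply: dist_powR_le => //; exact: ltW.
Qed.

Lemma magnification_perturbation zeta delta x w y (y' : 'rV[R]_N) : 0 <= zeta ->
  enorm (y' - y) <= delta -> enorm (x - w) <= delta ->
  enorm (zeta *: (y' - w) - zeta *: (y - x)) <= 2 * zeta * delta.
Proof.
move=> z0 yy xw; rewrite -scalerBr enormZ ger0_norm//.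
have -> : y' - w - (y - x) = (y' - y) + (x - w).
  by apply/rowP => i; rewrite !mxE; ring.
have := ler_enormD (y' - y) (x - w).
move=> h; have h2 : enorm (y' - y + (x - w)) <= 2 * delta by lra.
by have := ler_wpM2l z0 h2; rewrite mulrCA mulrA.
Qed.

(** In the magnified picture, passing between [X] and [Y] and between the base
points [x] and [w] costs [2 * zeta * delta], adjusting the length of vectors
costs as much again, and the rotation along the radial flow from radius [0] to
at most [2 / zeta] costs [C * 2 `^ a * zeta `^ (- a)]. One more [zeta `^ (- a)] is
the precision at which [tangent_vector_approx] is applied. *)
Lemma sam_dist_magnification_le X Y x w D C a zeta delta :
  0 < a -> 0 <= C -> has_radial_flow X x D C a -> X x ->
  0 < zeta -> 2 / zeta <= D -> 2 * zeta * delta <= 1 ->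
  X `<=` thickening Y delta -> Y `<=` thickening X delta ->
  enorm (x - w) <= delta ->
  (sam_dist (extrinsic_tangent_cone X x) (magnification zeta w Y) <=
   (4 * zeta * delta + (C * 2 `^ a + 1) * zeta `^ (- a))%:E)%E.
Proof.
move=> a0 C0 flow Xx z0 zD zd XY YX xw.
have zge0 : 0 <= zeta by exact: ltW.
have d0 : 0 <= delta by exact: le_trans (enorm_ge0 _) xw.
have zd0 : 0 <= zeta * delta by exact: mulr_ge0.
set b := zeta `^ (- a).
have b0 : 0 < b by exact: powR_gt0.
have rotation_le r : 0 < r -> r <= 2 / zeta -> C * r `^ a <= C * 2 `^ a * b.
  move=> r0 rz; rewrite -mulrA ler_wpM2l//.
  apply: (le_trans (ler_powR_base _ _ _ (ltW a0) r0 rz)).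
  rewrite powRM ?invr_ge0// /b powRN ler_wpM2l ?powR_ge0//.
  by rewrite -(powR_inv1 zge0) -!powRrM mulN1r powRN.
have rot0 : 0 <= C * 2 `^ a * b by rewrite !mulr_ge0 ?powR_ge0// ltW.
set eta := 4 * zeta * delta + (C * 2 `^ a + 1) * b.
have etaE : eta = 4 * (zeta * delta) + C * 2 `^ a * b + b by rewrite /eta; ring.
have zdE : 2 * zeta * delta = 2 * (zeta * delta) by ring.
have eball0E (v : 'rV[R]_N) : enorm v <= 1 -> eball 0 1 v.
  by rewrite /eball /= sub0r enormN.
have magnified y : X y -> exists2 z, (exists2 y', Y y' & zeta *: (y' - w) = z) &
    enorm (z - zeta *: (y - x)) <= 2 * (zeta * delta).
  move=> Xy; have [y' Yy' y'y] := XY y Xy.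
  exists (zeta *: (y' - w)); first by exists y'.
  by rewrite mulrA; exact: magnification_perturbation.
apply: ereal_inf_lbound; exists eta => //; split.
- rewrite etaE; move: zd0 rot0 b0; clear; lra.
- move=> v [Tv]; rewrite /eball /= sub0r enormN => v1.
  suff [z [Mz z1 zv]] : exists z, [/\ exists2 y', Y y' & zeta *: (y' - w) = z,
      enorm z <= 1 & enorm (z - v) <= eta].
    by exists z => //; split; [split=> //|]; exact: eball0E.
  have [vsmall|vlarge] := leP (enorm v) (2 * (zeta * delta)).
    have [z Mz zx] := magnified x Xx.
    rewrite subrr scaler0 subr0 in zx.
    exists z; split=> //; first by rewrite (le_trans zx)// -zdE.
    apply: (le_trans (ler_enormD _ _)); rewrite enormN etaE.
    move: zx vsmall rot0 b0; clear; lra.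
  have v0 : v != 0.
    apply/eqP => v0; move: vlarge; rewrite v0 enorm0; move: zd0; clear; lra.
  (* Shrinking the radius leaves room for the error in the unit ball. *)
  pose r := (enorm v - 2 * (zeta * delta)) / zeta.
  have zr : zeta * r = enorm v - 2 * (zeta * delta) by rewrite mulrCA divff ?mulr1// gt_eqF.
  have r0 : 0 < r by rewrite divr_gt0// subr_gt0.
  have rz : r <= 2 / zeta.
    rewrite ler_wpM2r ?invr_ge0//; move: v1 zd0; clear; lra.
  have [|y [Xy yr yv]] := tangent_vector_approx _ _ _ _ _ _ r b a0 C0 flow Tv v0 _ b0.
    by rewrite r0 /=; exact: le_trans rz zD.
  have [z Mz zy] := magnified y Xy.
  have zyE : zeta *: (y - x) = (zeta * r) *: direction x y.
    by rewrite -scalerA -yr scale_direction.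
  have dir1 : enorm (direction x y) = 1 by apply: enorm_direction; rewrite yr.
  have zy1 : enorm (zeta *: (y - x)) = enorm v - 2 * (zeta * delta).
    by rewrite zyE enormZ dir1 mulr1 ger0_norm ?zr// subr_ge0 ltW.
  exists z; split=> //.
    have := ler_enormD (z - zeta *: (y - x)) (zeta *: (y - x)).
    rewrite subrK zy1; move: zy v1; clear; lra.
  have -> : z - v = (z - zeta *: (y - x)) + ((zeta *: (y - x) - enorm v *: direction x y)
      + (enorm v *: direction x y - v)).
    by rewrite !addrA !subrK.
  apply: (le_trans (ler_enormD _ _)).
  have := ler_enormD (zeta *: (y - x) - enorm v *: direction x y)
    (enorm v *: direction x y - v).
  have -> : enorm (zeta *: (y - x) - enorm v *: direction x y) = 2 * (zeta * delta).
    rewrite zyE -scalerBl enormZ dir1 mulr1 zr distrC opprB addrC subrK.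
    by rewrite ger0_norm// -zdE -mulrA mulr_ge0.
  have h1 : enorm v * (C * r `^ a) <= C * 2 `^ a * b.
    apply: le_trans (rotation_le r r0 rz); rewrite ler_piMl// mulr_ge0//.
    exact: powR_ge0.
  rewrite etaE; move: yv h1 zy; clear.
  set E1 := enorm _; set E2 := enorm _; set E3 := enorm _; set E4 := _ * (C * _).
  set E5 := enorm _; lra.
- move=> _ [[[y' Yy' <-] _]]; set z := zeta *: (y' - w).
  rewrite /eball /= sub0r enormN => z1.
  have [y Xy yy'] := YX y' Yy'.
  have zy : enorm (z - zeta *: (y - x)) <= 2 * (zeta * delta).
    by rewrite mulrA; apply: magnification_perturbation => //; rewrite enormB.
  suff [v [Tv v1 vz]] : exists v, [/\ extrinsic_tangent_cone X x v,
      enorm v <= 1 & enorm (v - z) <= eta].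
    by exists v => //; split=> //; exact: eball0E.
  have [yx|yx] := eqVneq y x.
    exists 0; split; last 2 first.
    - by rewrite enorm0.
    - move: zy; rewrite yx subrr scaler0 subr0 sub0r enormN etaE.
      move: zd0 rot0 b0; clear; lra.
    move=> e e0; exists x; first by split=> //; rewrite /eball /= subrr enorm0 ltW.
    exists 0; last by rewrite subrr enorm0 ltW.
    by exists 0; rewrite ?scale0r//= lexx.
  have rho0 : 0 < enorm (y - x) by rewrite enorm_gt0// subr_eq0.
  have zrho : `|enorm z - zeta * enorm (y - x)| <= 2 * (zeta * delta).
    apply: le_trans zy; apply: le_trans (ler_enorm_dist _ _).
    by rewrite enormZ (ger0_norm zge0).
  have rhoz : enorm (y - x) <= 2 / zeta.
    rewrite ler_pdivlMr// mulrC; move: zrho z1 zd; rewrite ler_norml zdE; clear; lra.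
  have [|theta [th1 thy thT]] := direction_limit _ _ _ _ _ y a0 C0 flow Xy.
    by rewrite rho0; exact: le_trans rhoz zD.
  exists (enorm z *: theta); split.
  + by apply: thT; exact: enorm_ge0.
  + by rewrite enormZ th1 mulr1 ger0_norm// enorm_ge0.
  have -> : enorm z *: theta - z = enorm z *: (theta - direction x y) +
      ((enorm z - zeta * enorm (y - x)) *: direction x y + (zeta *: (y - x) - z)).
    rewrite scalerBl -(scalerA zeta) scale_direction scalerBr.
    by rewrite !addrA !subrK.
  apply: (le_trans (ler_enormD _ _)).
  have := ler_enormD ((enorm z - zeta * enorm (y - x)) *: direction x y)
    (zeta *: (y - x) - z).
  rewrite (enormZ (enorm z)) (enormZ (_ - _)) (enorm_direction _ _ rho0) mulr1.
  rewrite (ger0_norm (enorm_ge0 z)) (enormB _ z).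
  have h1 : enorm z * enorm (theta - direction x y) <= C * 2 `^ a * b.
    apply: le_trans (rotation_le _ rho0 rhoz); apply: le_trans thy.
    by rewrite ler_piMl// enorm_ge0.
  rewrite etaE; move: h1 zrho zy b0; clear.
  set E1 := _ * enorm (theta - _); set E2 := `|_|; set E3 := enorm (z - _).
  set E4 := enorm _; lra.
Qed.

End Cones.

(** * The convergence rate *)

Theorem proposition4p23 (R : realType) (N : nat) (disp : Order.disp_t)
    (P : porderType disp) (X : set 'rV[R]_N) (s : 'rV[R]_N -> P)
    (hW : lojasiewicz_whitney X s) (p : P) (K : set 'rV[R]_N)
    (hK : compact K) (hKp : K `<=` stratum X s p) :
  exists d C alpha : R, [/\ 0 < d, 0 < C, 0 < alpha &
    forall zeta : R, 0 < zeta -> 0 <= 1 / zeta <= d ->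
    exists2 eps0 : R, 0 < eps0 &
    forall (Y : set 'rV[R]_N) (eps : R),
      hausdorff_dist Y X = eps%:E -> eps <= eps0 ->
    forall w x : 'rV[R]_N, K x -> enorm (x - w) <= eps ->
      (sam_dist (extrinsic_tangent_cone X x) (magnification zeta w Y)
       <= (C * (zeta `^ (- alpha) + zeta * eps))%:E)%E].
Proof.
have [[lcX _ _ _ _ _] loj] := hW.
have KX : K `<=` X by move=> x /hKp[].
have [D0 D00 cX] := locally_closed_uniform X K lcX hK KX.
have [a [d0 [a0 d00 betaK]]] := loj K p hK hKp.
(* The last bound makes D `^ a at most 1 / 6, so that the tangents found below
   deviate from the radial direction by at most 1 / 3. *)
pose D := Num.min (Num.min d0 D0) ((1 / 6) `^ a^-1).
have Dpos : 0 < D by rewrite !lt_min d00 D00 powR_gt0// divr_gt0.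
have Dd0 : D <= d0 by rewrite /D !ge_min lexx.
have DD0 : D <= D0 by rewrite /D !ge_min lexx orbT.
have Da : D `^ a <= 1 / 6.
  have Dle : D <= (1 / 6) `^ a^-1 by rewrite /D ge_min lexx orbT.
  apply: (le_trans (ler_powR_base _ _ _ (ltW a0) Dpos Dle)).
  by rewrite -powRrM mulVf ?gt_eqF// powRr1// divr_ge0.
pose C := rotation_rate a.
have C0 : 0 <= C by exact: rotation_rate_ge0.
have flow x : K x -> has_radial_flow X x D C a.
  move=> Kx; apply: (radial_flow X x D a a0 Da (cX x D Kx DD0)) => y Xy /andP[rho0 rhoD].
  apply: (@beta_tangent _ _ _ _ X s) => //.
  have Xy_d0 : (X `&` eball x d0) y.
    by split=> //; rewrite /eball /= enormB; exact: le_trans Dd0.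
  (* The factor 2 makes the bound strict: the distance of the unit secant vector
     to the tangent space is an infimum and need not be attained. *)
  have := betaK y x Kx Xy_d0; rewrite enormB => /le_lt_trans; apply.
  have : 0 < enorm (y - x) `^ a by exact: powR_gt0.
  by clear; lra.
have CC0 : 0 <= C * 2 `^ a by rewrite mulr_ge0// powR_ge0.
(* The summand 5 consists of the precision 1 in sam_dist_magnification_le and of
   4 times the excess of the thickening radius over eps, chosen below. *)
exists (D / 2), (C * 2 `^ a + 5), a; split=> //.
- by rewrite divr_gt0.
- by rewrite ltr_wpDl.
move=> zeta z0 /andP[_ zD].
exists (1 / (4 * zeta)); first by rewrite divr_gt0// mulr_gt0.
move=> Y eps dYX eps_le w x Kx xw.
have eps0 : 0 <= eps by exact: le_trans (enorm_ge0 _) xw.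
set b := zeta `^ (- a).
have b0 : 0 < b by exact: powR_gt0.
(* The infimum defining the Hausdorff distance need not be attained; the slack
   is small enough to be absorbed into b after magnification. *)
pose slack := Num.min (1 / (4 * zeta)) (b / zeta).
have slack0 : 0 < slack by rewrite lt_min !divr_gt0// mulr_gt0.
have slackb : zeta * slack <= b.
  by rewrite -ler_pdivlMl// mulrC ge_min lexx orbT.
have slackz : slack <= 1 / (4 * zeta) by rewrite ge_min lexx.
have [_ [r [_ YXr XYr] <-]] : exists2 t, [set r%:E | r in [set r | [/\ 0 < r,
    Y `<=` thickening X r & X `<=` thickening Y r]]] t & (t < (eps + slack)%:E)%E.
  by apply: ereal_inf_lt; rewrite -/(hausdorff_dist Y X) dYX lte_fin ltrDl.
rewrite lte_fin => r_lt.
have thick_mono (A : set 'rV[R]_N) : thickening A r `<=` thickening A (eps + slack).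
  by move=> v [u Au uv]; exists u => //; exact: le_trans (ltW r_lt).
have bound := sam_dist_magnification_le X Y x w D C a zeta (eps + slack)
  a0 C0 (flow x Kx) (KX x Kx) z0 _ _ (subset_trans XYr (thick_mono _))
  (subset_trans YXr (thick_mono _)) _.
apply: le_trans (bound _ _ _) _.
- by move: zD; rewrite ler_pdivlMr// mulrC mulrA mulr1.
- have : eps + slack <= 2 * (1 / (4 * zeta)).
    by move: eps_le slackz; clear; set q := 1 / _; lra.
  move=> /(ler_wpM2l (ltW z0)).
  have -> : zeta * (2 * (1 / (4 * zeta))) = 1 / 2 by field; rewrite gt_eqF.
  by clear; lra.
- by rewrite (le_trans xw)// lerDl ltW.
rewrite lee_fin -/b.
have h1 : 0 <= (C * 2 `^ a + 1) * (zeta * eps).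
  by rewrite !mulr_ge0 ?(ltW z0)// addr_ge0.
move: slackb h1; clear; set c := C * 2 `^ a; lra.
Qed.
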